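(* Let $T>0$. For any piecewise-$C^1$ function $P:[t_0,t_0+T]\to\mathbb H^n$ and any trajectory $X(\cdot)$ with values in $\mathbb H^{n+m}_{\succeq0}$ satisfying the impulsive system $$E\dot X(t)E^*=\mathcal F(t,X(t))\ (t\neq t_k),\qquad EX(t_k^+)E^*=\mathcal J(k,X(t_k^-)),$$ with $EX(t_0)E^*=X_1^0$, one has $$\begin{aligned}J_T(X,X_1^0)=\;&\langle P(t_0),X_1^0\rangle+\langle Z_T-P(t_0+T),EX(t_0+T)E^*\rangle\\&+\int_{t_0}^{t_0+T}\langle\mathcal C_Z(t,P(t)),X(t)\rangle\,dt+\sum_{k=1}^{N_T}\langle\mathcal D_Z(k,P(t_k^+),P(t_k^-)),X(t_k^-)\rangle .\end{aligned}$$ When $P(t_0+T)=Z_T$ the second term vanishes: $$J_T(X,X_1^0)=\langle P(t_0),X_1^0\rangle+\int_{t_0}^{t_0+T}\langle\mathcal C_Z(t,P(t)),X(t)\rangle\,dt+\sum_{k=1}^{N_T}\langle\mathcal D_Z(k,P(t_k^+),P(t_k^-)),X(t_k^-)\rangle .$$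
   Context: Notation. Fix integers $n,m\ge1$. $\mathbb H^p$ and $\mathbb H^p_{\succeq0}$ are the $p\times p$ complex Hermitian, resp. positive semidefinite Hermitian, matrices; $\langle A,B\rangle=\operatorname{trace}(AB^* )$. $E=[I_n\ \ 0]\in\mathbb C^{n\times(n+m)}$. $f(t^\pm)$ are right/left limits. System. There are jump times $t_1<t_2<\cdots$, $t_k\to\infty$. The flow operator $\mathcal F(t,\cdot):\mathbb H^{n+m}\to\mathbb H^n$ is linear, bounded, continuous in $t$; the jump operator $\mathcal J(k,\cdot):\mathbb H^{n+m}\to\mathbb H^n$ is linear and bounded; both leave the positive semidefinite cone invariant (the state block $EXE^*$ stays positive semidefinite). Their adjoints $\mathcal F^*(t,\cdot),\mathcal J^*(k,\cdot):\mathbb H^n\to\mathbb H^{n+m}$ satisfy $\langle P,\mathcal F(t,X)\rangle=\langle\mathcal F^*(t,P),X\rangle$ and $\langle P,\mathcal J(k,X)\rangle=\langle\mathcal J^*(k,P),X\rangle$. The initial state block is $X_1^0\in\mathbb H^n_{\succeq0}$. A trajectory is a function $X(\cdot)$ with values in $\mathbb H^{n+m}_{\succeq0}$ satisfying the displayed equations (regular enough that the one-sided limits, derivatives and integrals involved make sense). Cost. $\{t_k\}_{k=1}^{N_T}$ are the jump times in $(t_0,t_0+T)$. With $Z(t)\in\mathbb H^{n+m}$, $Z(t)\succeq0$, $Z_k\in\mathbb H^{n+m}_{\succeq0}$, $Z_T\in\mathbb H^n_{\succeq0}$, $$J_T(X,X_1^0)=\int_{t_0}^{t_0+T}\langle Z(t),X(t)\rangle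 dt+\sum_{k=1}^{N_T}\langle Z_k,X(t_k^-)\rangle+\langle Z_T,EX(t_0+T)E^*\rangle.$$ Composite operators. $\mathcal C_Z(t,P(t))=E^*\dot P(t)E+\mathcal F^*(t,P(t))+Z(t)$ and $\mathcal D_Z(k,P(t_k^+),P(t_k^-))=\mathcal J^*(k,P(t_k^+))-E^*P(t_k^-)E+Z_k$, both in $\mathbb H^{n+m}$. Piecewise-$C^1$ functions $P$ are continuous and piecewise $C^1$ between consecutive jump times, with one-sided limits at (and possible discontinuities only at) the jump times. *)

(* Defs.v *)
From HB Require Import structures.
From mathcomp Require Export all_boot all_order all_algebra.
From mathcomp Require Export complex.
From mathcomp Require Export all_classical all_reals all_analysis.

Export Order.TTheory GRing.Theory Num.Theory.
Export numFieldNormedType.Exports.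

Set Implicit Arguments.
Unset Strict Implicit.
Unset Printing Implicit Defensive.

Local Open Scope classical_set_scope.
Local Open Scope ring_scope.
Local Open Scope sesquilinear_scope.

Section Matrices.
Variable R : realType.
Local Notation C := R[i].

(* In R[i], 0 <= z says that z is real and nonnegative. *)
Definition psdmx p (A : 'M[C]_p) : Prop :=
  A \is hermsymmx /\ forall v : 'cV[C]_p, 0 <= (v ^t* *m A *m v) 0 0.

(* <A, B> = trace (A B^* ), valued in R so that it can be integrated. On
   Hermitian matrices the trace is real: see mxdot_trace. *)
Definition mxdot p (A B : 'M[C]_p) : R := complex.Re (\tr (A *m B ^t*)).

Lemma mxdot_trace p (A B : 'M[C]_p) : A \is hermsymmx -> B \is hermsymmx ->
  (mxdot A B)%:C%C = \tr (A *m B ^t*).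
Proof.
move=> /is_hermitianmxP; rewrite expr0 scale1r => Ah.
move=> /is_hermitianmxP; rewrite expr0 scale1r => Bh.
rewrite /mxdot -Bh; apply: RRe_real; rewrite CrealE -trace_map_mx map_mxM /=.
have cA : A ^ Num.Def.conjC = A^T by rewrite [in RHS]Ah map_trmx trmxK.
have cB : B ^ Num.Def.conjC = B^T by rewrite [in RHS]Bh map_trmx trmxK.
by rewrite cA cB -trmx_mul mxtrace_tr mxtrace_mulC.
Qed.

Definition mxfrob p (A : 'M[C]_p) : R := Num.sqrt (mxdot A A).

Definition state_proj n m : 'M[C]_(n, n + m) := row_mx 1%:M 0.

Definition state_block n m (X : 'M[C]_(n + m)) : 'M[C]_n :=
  state_proj n m *m X *m (state_proj n m) ^t*.

End Matrices.

(* Limits and derivatives of matrix-valued functions of a real variable are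
   taken on the real and imaginary parts of the entries. *)
Section Calculus.
Variables (R : realType) (p : nat).
Local Notation C := R[i].
Implicit Types (f : R -> 'M[C]_p) (L : 'M[C]_p) (G : set_system R).

Definition mxre f (i j : 'I_p) (s : R) : R := complex.Re (f s i j).
Definition mxim f (i j : 'I_p) (s : R) : R := complex.Im (f s i j).

Definition mxcvg_to G f L : Prop := forall i j,
  mxre f i j @ G --> complex.Re (L i j) /\ mxim f i j @ G --> complex.Im (L i j).

Definition mxcvg G f : Prop := exists L, mxcvg_to G f L.

Definition mxlim G f : 'M[C]_p :=
  \matrix_(i, j) (lim (mxre f i j @ G) +i* lim (mxim f i j @ G))%C.

Definition mxderivable f (t : R) : Prop := forall i j,
  derivable (mxre f i j) t 1 /\ derivable (mxim f i j) t 1.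

Definition mxderive f (t : R) : 'M[C]_p :=
  \matrix_(i, j) (derive1 (mxre f i j) t +i* derive1 (mxim f i j) t)%C.

Definition mxintegrable (a b : R) f : Prop := forall i j,
  lebesgue_measure.-integrable `[a, b] (EFin \o mxre f i j) /\
  lebesgue_measure.-integrable `[a, b] (EFin \o mxim f i j).

(* D is the finite set of kinks of f, and jumps the set of points at which f
   may be discontinuous. At a and b only the limits from inside ]a, b[ count,
   so f is continuous at a and b even when they belong to jumps. *)
Definition piecewise_C1 (a b : R) (jumps : set R) f : Prop :=
  exists2 D : set R, finite_set D &
  [/\ mxcvg_to a^'+ f (f a) /\ mxcvg_to b^'- f (f b),
      forall t, a < t < b -> ~ jumps t -> mxcvg_to (nbhs t) f (f t),
      forall t, a < t < b -> jumps t -> mxcvg t^'- f /\ mxcvg t^'+ f,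
      forall t, a < t < b -> ~ jumps t -> ~ D t ->
        mxderivable f t /\ mxcvg_to (nbhs t) (mxderive f) (mxderive f t) &
      (forall t, a <= t < b -> mxcvg t^'+ (mxderive f)) /\
      (forall t, a < t <= b -> mxcvg t^'- (mxderive f))].

End Calculus.

Section System.
Variable R : realType.
Local Notation C := R[i].

(* Bounded real-linear operators from p x p to q x q Hermitian matrices; the
   values on non-Hermitian matrices are irrelevant. *)
Definition herm_operator p q (L : 'M[C]_p -> 'M[C]_q) : Prop :=
  [/\ forall A, A \is hermsymmx -> L A \is hermsymmx,
      forall (a : R) A B, A \is hermsymmx -> B \is hermsymmx ->
        L (a%:C%C *: A + B) = a%:C%C *: L A + L B &
      exists M : R, forall A, A \is hermsymmx -> mxfrob (L A) <= M * mxfrob A].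

Definition adjoint_operator p q
    (L : 'M[C]_p -> 'M[C]_q) (Ls : 'M[C]_q -> 'M[C]_p) : Prop :=
  (forall B, B \is hermsymmx -> Ls B \is hermsymmx) /\
  forall A B, A \is hermsymmx -> B \is hermsymmx ->
    mxdot B (L A) = mxdot (Ls B) A.

Variables n m : nat.

(* F t is the right-hand side of a differential equation: it does not map the
   cone into itself, its flow leaves the cone invariant. This is expressed by
   the tangency condition at the boundary: where the quadratic form of the
   state block vanishes, its derivative is nonnegative. *)
Definition flow_operator (t0 : R) (F : R -> 'M[C]_(n + m) -> 'M[C]_n) : Prop :=
  [/\ forall t, t0 <= t -> herm_operator (F t),
      forall A, A \is hermsymmx -> forall i j,
        {within `[t0, +oo[, continuous (mxre (F ^~ A) i j)} /\
        {within `[t0, +oo[, continuous (mxim (F ^~ A) i j)} &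
      forall t X (v : 'cV[C]_n), t0 <= t -> psdmx X ->
        (v ^t* *m state_block X *m v) 0 0 = 0 ->
        0 <= (v ^t* *m F t X *m v) 0 0].

Definition jump_operator (J : 'M[C]_(n + m) -> 'M[C]_n) : Prop :=
  herm_operator J /\ forall X, psdmx X -> psdmx (J X).

(* tau 0 is the initial time t_0 and tau k, for k >= 1, the jump time t_k. *)
Implicit Type tau : nat -> R.

Definition jump_times tau : set R := [set t | exists2 k, (0 < k)%N & t = tau k].

Definition jump_sequence tau : Prop :=
  {homo tau : i j / (i < j)%N >-> i < j} /\ tau k @[k --> \oo] --> +oo.

(* N is the number N_T of jump times in ]t_0, t_0 + T[. *)
Definition jump_count tau (T : R) (N : nat) : Prop :=
  forall k, (0 < k)%N -> (tau k < tau 0 + T) = (k <= N)%N.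

(* The derivative E X' E^* is that of the state block, so that no
   differentiability of the other blocks of X is required. The state block is
   continuous from inside at both ends of the horizon: X (t_0 + T) is read
   before the jump when t_0 + T is itself a jump time. *)
Definition trajectory tau (T : R)
    (F : R -> 'M[C]_(n + m) -> 'M[C]_n) (J : nat -> 'M[C]_(n + m) -> 'M[C]_n)
    (X10 : 'M[C]_n) (X : R -> 'M[C]_(n + m)) : Prop :=
  let X1 t := state_block (X t) in
  [/\ (forall t, tau 0 <= t <= tau 0 + T -> psdmx (X t)) /\
        mxintegrable (tau 0) (tau 0 + T) X,
      X1 (tau 0) = X10,
      mxcvg_to (tau 0)^'+ X1 (X1 (tau 0)) /\
        mxcvg_to (tau 0 + T)^'- X1 (X1 (tau 0 + T)),
      forall t, tau 0 < t < tau 0 + T -> ~ jump_times tau t ->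
        mxderivable X1 t /\ mxderive X1 t = F t (X t) &
      forall k, (0 < k)%N -> tau k < tau 0 + T ->
        [/\ mxcvg (tau k)^'- X, mxcvg (tau k)^'+ X1 &
            mxlim (tau k)^'+ X1 = J k (mxlim (tau k)^'- X)]].

Definition cost tau (T : R) (N : nat) (Z : R -> 'M[C]_(n + m))
    (Zk : nat -> 'M[C]_(n + m)) (ZT : 'M[C]_n) (X : R -> 'M[C]_(n + m)) : R :=
  \int[lebesgue_measure]_(t in `[tau 0, tau 0 + T]) mxdot (Z t) (X t)
  + \sum_(1 <= k < N.+1) mxdot (Zk k) (mxlim (tau k)^'- X)
  + mxdot ZT (state_block (X (tau 0 + T))).

(* At the finitely many t where P is not differentiable, the value of
   mxderive P t is immaterial: flow_composite is only integrated. *)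
Definition flow_composite (Fs : R -> 'M[C]_n -> 'M[C]_(n + m))
    (Z : R -> 'M[C]_(n + m)) (P : R -> 'M[C]_n) (t : R) : 'M[C]_(n + m) :=
  (state_proj R n m) ^t* *m mxderive P t *m state_proj R n m + Fs t (P t) + Z t.

Definition jump_composite (Js : nat -> 'M[C]_n -> 'M[C]_(n + m))
    (Zk : nat -> 'M[C]_(n + m)) (k : nat) (Pplus Pminus : 'M[C]_n) :
    'M[C]_(n + m) :=
  Js k Pplus - (state_proj R n m) ^t* *m Pminus *m state_proj R n m + Zk k.

End System.

(* Main.v *)
Require Import Defs.
From mathcomp Require Import ring lra measurable_realfun.

Set Implicit Arguments.
Unset Strict Implicit.
Unset Printing Implicit Defensive.

(** The identity is integration by parts for g t = <P t, X1 t>, where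
    X1 = E X E^* is the state block.

    Between jumps and kinks, g' = <P', X1> + <P, X1'> and X1' = F t (X t), so
    moving E and F to their adjoints gives g' = <C_Z (t, P), X> - <Z, X>.  At a
    jump time, the jump equation and the adjoint of J turn the jump
    <P (t_k+), X1 (t_k+)> - <P (t_k-), X1 (t_k-)> of g into
    <D_Z (k, P+, P-), X (t_k-)> - <Z_k, X (t_k-)>.  Integrating g' and
    adding the jumps of g recovers g (t_0 + T) - g (t_0); solving for the cost
    gives the claim.

    The delicate point is that X is only Lebesgue integrable, so g' need not be
    continuous, nor even bounded, and the fundamental theorem of calculus for
    continuous derivatives does not apply.  What holds is that a function with
    a derivative at every point, the derivative being Lebesgue integrable, is
    the integral of that derivative (integral_derivative).  The proof is by
    majorization.  If h = f' is bounded below, a slight enlargement of the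
    integral of h yields a function U which grows at every point at least as
    fast as f (major_function: the superlevel sets of h are enlarged to open
    sets of almost the same measure), so U - f has nonnegative lower right
    derivatives and is not smaller at the end than at the beginning
    (dini_ge0_le).  This bounds the increment of f by the integral of h;
    truncating h from below and applying dominated convergence removes the
    bound, and - f gives the converse inequality.  Splitting the interval
    handles finitely many kinks (integral_derivative_kinks) and jumps
    (integral_derivative_jumps).

    That g' is integrable follows from two facts.  P and P' have one-sided
    limits everywhere and finitely many discontinuities, hence are bounded and
    measurable.  A Hermitian matrix is a real combination of finitely many
    fixed Hermitian matrices, so F t (X t) is a finite sum of continuous
    functions of t multiplied by integrable coordinates of X t
    (integrable_herm_operator). *)

Local Open Scope classical_set_scope.
Local Open Scope ring_scope.
Local Notation mu := lebesgue_measure.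
Local Notation Re := complex.Re.
Local Notation Im := complex.Im.

(** * Functions with integrable derivatives *)

(** The points x at which G x >= G a - e - e (x - a) form a set whose supremum s
    belongs to it, because G cannot drop when s is reached from the left; and s
    is b, because just after s the function G decreases with slope at most e.
    The additive e absorbs the endpoint a, where no one-sided derivative of G is
    controlled, only its right limit. *)
Lemma dini_ge0_le (R : realType) (G : R -> R) (a b : R) : a < b ->
  (forall e, 0 < e -> \forall t \near a^'+, G a - e <= G t) ->
  (forall x e, a < x <= b -> 0 < e -> \forall t \near x^'-, G t <= G x + e) ->
  (forall x e, a < x < b -> 0 < e ->
    \forall t \near x^'+, G x - e * (t - x) <= G t) ->
  G a <= G b.
Proof.
move=> ab Ga Gl Gr.
suff key e : 0 < e -> G a - e - e * (b - a) <= G b.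
  apply/ler_addgt0Pr => e e0.
  have d0 : 0 < e / (1 + (b - a)) by rewrite divr_gt0// addr_gt0// subr_gt0.
  have := key _ d0; rewrite -addrA -opprD -{1}[_ / _]mulr1 -mulrDr.
  by rewrite divfK ?lerBlDr// gt_eqF// addr_gt0// subr_gt0.
move=> e0.
pose S := [set x | a <= x <= b /\ G a - e - e * (x - a) <= G x].
have Sa : S a by split; [rewrite lexx ltW|rewrite subrr mulr0 subr0 gerBl ltW].
have Sub : ubound S b by move=> x [/andP[]].
have supS : has_sup S by split; [exists a|exists b].
set s := sup S.
have as_ : a <= s by exact: sup_upper_bound.
have sb : s <= b by apply: ge_sup => //; exists a.
have Ss : S s.
  split; first by rewrite as_.
  move: as_; rewrite le_eqVlt => /predU1P[<-|as_].
    by rewrite subrr mulr0 subr0 gerBl ltW.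
  apply/ler_addgt0Pr => d d0.
  have : \forall t \near s^'-, t <= s /\ G t <= G s + d.
    near=> t; split; first by near: t; exact: nbhs_left_le.
    by near: t; apply: Gl; rewrite ?as_.
  move=> [r /= r0 rS].
  have [x Sx] := sup_adherent r0 supS.
  rewrite -/s => sx.
  have xs : x <= s by exact: sup_upper_bound.
  have Gx : G x <= G s + d.
    move: xs; rewrite le_eqVlt => /predU1P[->|xs]; first by rewrite lerDl ltW.
    apply: (rS x _ xs).2 => /=.
    by rewrite ger0_norm ?subr_ge0 1?ltW// ltrBlDl -ltrBlDr.
  apply: le_trans Gx; apply: le_trans Sx.2.
  by rewrite lerD2l lerN2 ler_pM2l// lerD2r.
move: sb; rewrite le_eqVlt => /predU1P[<-|sb]; first exact: Ss.2.
have grow : \forall t \near s^'+, G a - e - e * (t - a) <= G t.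
  move: (as_); rewrite le_eqVlt => /predU1P[E|as'].
    near=> t; apply: (@le_trans _ _ (G a - e)); last first.
      by near: t; rewrite -E; exact: Ga.
    by rewrite gerBl mulr_ge0 ?(ltW e0)// subr_ge0 E.
  near=> t; apply: (@le_trans _ _ (G s - e * (t - s))).
    have := Ss.2; lra.
  by near: t; apply: Gr; rewrite ?as'.
have : \forall t \near s^'+, s < t /\ S t.
  near=> t; have st : s < t by near: t; exact: nbhs_right_gt.
  split => //; split; last by near: t.
  rewrite (le_trans as_ (ltW st))/=.
  by near: t; exact: nbhs_right_le.
case/filter_ex => t [st /(sup_upper_bound supS)].
by rewrite leNgt st.
Unshelve. all: by end_near. Qed.

(** Discretized layer cake formula: y / d is at least the number of positive
    multiples of d below y, and the multiple 0 adds one. *)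
Lemma layer_cake_le (R : realType) (d y : R) n : 0 < d -> 0 <= y ->
  \sum_(k < n) (k%:R * d <= y)%R%:R <= y / d + 1.
Proof.
move=> d0 y0; elim: n => [|n IH].
  by rewrite big_ord0 addr_ge0// divr_ge0// ltW.
rewrite big_ord_recr/=; case: (leP (n%:R * d) y) => h; last by rewrite addr0.
rewrite lerD//; apply: (@le_trans _ _ n%:R); last by rewrite ler_pdivlMr.
apply: (@le_trans _ _ (\sum_(k < n) 1)).
  by apply: ler_sum => i _; case: (i%:R * d <= y) => /=; rewrite ?ler01.
by rewrite sumr_const card_ord.
Qed.

(** The layer cake bound at each point, integrated over the segment. *)
Lemma sum_measure_superlevel_le (R : realType) (g : R -> R) (a b d : R) :
  a < b -> 0 < d ->
  (forall x, a <= x <= b -> 0 <= g x) ->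
  lebesgue_measure.-integrable `[a, b] (EFin \o g) ->
  (\sum_(0 <= k <oo)
     lebesgue_measure (`[a, b] `&` [set x | (k%:R * d <= g x)%R]) <=
   ((\int[lebesgue_measure]_(x in `[a, b]) g x) / d + (b - a))%:E)%E.
Proof.
move=> ab d0 g0 gi.
set D := `[a, b]%classic.
have mD : measurable D by exact: measurable_itv.
have mg : measurable_fun D g by apply/measurable_EFinP; case/integrableP: gi.
pose A k := D `&` [set x | k%:R * d <= g x].
have mA k : measurable (A k) by exact: measurable_fun_le.
have m1 k : measurable_fun D (fun x => (\1_(A k) x : R)%:E).
  by apply/measurable_EFinP; apply: measurable_indic; exact: mA.
apply: lime_le; first exact: is_cvg_nneseries.
apply: nearW => n; rewrite big_mkord.
have -> : (\sum_(k < n) mu (A k) =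
  \int[mu]_(x in D) \sum_(k < n) (\1_(A k) x)%:E)%E.
  rewrite ge0_integral_sum//.
    apply: eq_bigr => k _; rewrite integral_indic//.
    by congr (mu _); rewrite /A setIAC setIid.
    exact: mA.
  by move=> k; exact: m1.
have gdi : mu.-integrable D (fun x => (g x / d)%:E).
  under eq_fun do rewrite mulrC EFinM.
  exact: integrableZl.
have c1i : mu.-integrable D (EFin \o cst 1).
  apply: continuous_compact_integrable; first exact: segment_compact.
  exact: cst_continuous.
have gi' : mu.-integrable D (fun x => (g x / d + 1)%:E).
  under eq_fun do rewrite EFinD.
  exact: (integrableD _ gdi c1i).
apply: (@le_trans _ _ (\int[mu]_(x in D) (g x / d + 1)%:E)%E).
  apply: ge0_le_integral => //.
  - by move=> x Dx; rewrite sume_ge0// => k _; rewrite lee_fin.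
  - apply: emeasurable_sum => k ?; exact: m1.
  - by case/integrableP: gi'.
  - move=> x Dx; rewrite sumEFin lee_fin.
    apply: le_trans (layer_cake_le n d0 (g0 _ Dx)).
    apply: ler_sum => k _; rewrite indicE; case: (boolP (x \in A k)) => //.
    by rewrite inE => -[_ ->].
rewrite -[leLHS]fineK; last by apply: integrable_fin_num.
rewrite lee_fin -/(Rintegral mu D (fun x => g x / d + 1)).
rewrite RintegralD// RintegralZr// Rintegral_cst// lerD2l mul1r.
rewrite [X in fine X](_ : _ = (b - a)%:E)//.
by have := lebesgue_measure_itv `[a, b]; rewrite /= lte_fin ab.
Qed.

(** The value U t is d times the total measure, over all k, of the parts
    in ]a, t] of open sets W k slightly larger than A k = {k d <= g}.  If
    n d <= g x < (n + 1) d, then x lies in the n + 1 open sets W 0, ..., W n, so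
    just after x the slope of U is at least (n + 1) d > g x.  The layer cake
    bound makes the loss at most d (b - a), and outer regularity makes the
    enlargement as small as desired: each takes half of e. *)
Lemma major_function (R : realType) (g : R -> R) (a b e : R) :
  a < b -> 0 < e ->
  (forall x, a <= x <= b -> 0 <= g x) ->
  mu.-integrable `[a, b] (EFin \o g) ->
  exists U : R -> R,
  [/\ U a = 0, U b <= \int[mu]_(x in `[a, b]) g x + e,
      (forall x y, a <= x -> x <= y -> y <= b -> U x <= U y) &
      forall x, a < x < b -> \forall t \near x^'+, g x * (t - x) <= U t - U x].
Proof.
move=> ab e0 g0 gi.
have ba : 0 < b - a by rewrite subr_gt0.
pose d := e / 2 / (b - a).
have d0 : 0 < d by rewrite !divr_gt0.
pose D := `[a, b]%classic.
have mD : measurable D by exact: measurable_itv.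
have mg : measurable_fun D g by apply/measurable_EFinP; case/integrableP: gi.
pose A k := D `&` [set x | k%:R * d <= g x].
have mA k : measurable (A k) by exact: measurable_fun_le.
have Afin k : (mu (A k) < +oo)%E.
  apply: (@le_lt_trans _ _ (mu D)).
    by apply: le_measure; rewrite ?inE//; [exact: mA|exact: subIsetl].
  by rewrite /D lebesgue_measure_itv/= lte_fin ab -EFinB ltry.
have h0 : 0 < e / 2 / d by rewrite !divr_gt0.
have hk k : 0 < e / 2 / d / (2 ^ k.+1)%:R by rewrite divr_gt0// ltr0n expn_gt0.
have /choice [W WP] : forall k, exists W : set R, [/\ open W, A k `<=` W &
    (mu (W `\` A k) < (e / 2 / d / (2 ^ k.+1)%:R)%:E)%E].
  move=> k; have [W ?] := lebesgue_regularity_outer (mA k) (Afin k) (hk k).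
  by exists W.
have mO k : measurable (W k) by apply: open_measurable; case: (WP k).
pose v x y k := mu (W k `&` `]x, y]).
have mv x y k : measurable (W k `&` `]x, y]).
  by apply: measurableI => //; exact: measurable_itv.
pose V x y := (\sum_(0 <= k <oo) v x y k)%E.
have V0 x y : (0 <= V x y)%E by apply: nneseries_ge0 => *; exact: measure_ge0.
have VD x y z : x <= y -> y <= z -> (V x z = V x y + V y z)%E.
  move=> xy yz; rewrite /V -nneseriesD; [|by move=> *; exact: measure_ge0..].
  apply: eq_eseriesr => k _; rewrite /v -measureU//=; [|exact: mv|exact: mv|].
    rewrite -setIUr -itv_bndbnd_setU//.
  rewrite -subset0 => w [[_ /=]]; rewrite !in_itv/=.
  move=> /andP[_ wy] [_ /andP[yw _]].
  by move: (lt_le_trans yw wy); rewrite ltxx.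
have Vab : (V a b <= ((\int[mu]_(x in D) g x + e) / d)%:E)%E.
  apply: (@le_trans _ _ (\sum_(0 <= k <oo)
      (mu (A k) + (e / 2 / d / (2 ^ k.+1)%:R)%:E))%E).
    apply: lee_nneseries => [k _ _|k _]; first exact: measure_ge0.
    have [_ AO OA] := WP k.
    apply: (@le_trans _ _ (mu (W k))).
      by apply: le_measure; rewrite ?inE; [exact: mv|exact: mO|exact: subIsetl].
    rewrite -(setDUK AO) measureU//; last 3 first.
    - exact: mA.
    - by apply: measurableD; [exact: mO|exact: mA].
    - by rewrite setDE setICA setICr setI0.
    by rewrite leeD2l// ltW.
  apply: (le_trans (epsilon_trick _ _ _)) => [k||].
  - exact: measure_ge0.
  - exact: ltW.
  apply: (le_trans (leeD2r _ (sum_measure_superlevel_le ab d0 g0 gi))).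
  rewrite -EFinD lee_fin mulrDl -addrA lerD2l.
  have -> : e / 2 / d = b - a.
    by rewrite /d; field; rewrite (gt_eqF ba) (gt_eqF e0).
  have -> : e / d = (b - a) + (b - a).
    by rewrite /d; field; rewrite (gt_eqF ba) (gt_eqF e0).
  by [].
have Vfin x y : a <= x -> x <= y -> y <= b -> V x y \is a fin_num.
  move=> ax xy yb; rewrite ge0_fin_numE//.
  apply: le_lt_trans (le_lt_trans Vab (ltry _)).
  rewrite (VD a x b)// ?(le_trans xy)// (VD x y b)//.
  by rewrite addeCA leeDl// adde_ge0.
pose U y := d * fine (V a y).
have UD x y : a <= x -> x <= y -> y <= b -> U y - U x = d * fine (V x y).
  move=> ax xy yb.
  rewrite /U (VD a x y)// fineD ?Vfin// ?(le_trans xy)//.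
  by rewrite mulrDr addrC addKr.
exists U; split.
- rewrite /U [V a a](_ : _ = 0%E) ?mulr0//.
  apply: eseries0 => k _ _; rewrite /v set_itv_ge ?setI0 ?measure0//.
  by rewrite bnd_simp ltxx.
- rewrite /U mulrC -ler_pdivlMr// -lee_fin fineK//.
  by rewrite Vfin// ltW.
- move=> x y ax xy yb; rewrite -subr_ge0 UD// mulr_ge0 ?fine_ge0//.
  exact: ltW.
move=> x /andP[ax xb].
have gx0 : 0 <= g x by rewrite g0// !ltW.
pose n := Num.truncn (g x / d).
have [nle nlt] : n%:R * d <= g x /\ g x <= n.+1%:R * d.
  have /truncn_itv/andP[? /ltW ?] := divr_ge0 gx0 (ltW d0).
  by split; [rewrite -ler_pdivlMr|rewrite -ler_pdivrMr].
have : \forall y \near x, forall k : 'I_n.+1, W k y.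
  have nW k : (k < n.+1)%N -> nbhs x (W k).
    move=> kn; have [oO AO _] := WP k.
    apply: open_nbhs_nbhs; split => //; apply: AO; split.
      by rewrite /D/= in_itv/= !ltW.
    by rewrite /=; apply: le_trans nle; rewrite ler_pM2r// ler_nat.
  exact: (@filter_forall R 'I_n.+1 (fun k => W k) (nbhs x) (nbhs_filter x)
    (fun k => nW k (ltn_ord k))).
move=> /nbhs_ballP[r /= r0 rO].
near=> t.
have xt : x < t by near: t; exact: nbhs_right_gt.
have tb : t <= b by near: t; exact: nbhs_right_le.
have tr : t < x + r by near: t; apply: nbhs_right_lt; rewrite ltrDl.
rewrite UD ?(ltW xt)// ?(ltW ax)//.
apply: (@le_trans _ _ (d * (n.+1%:R * (t - x)))).
  by rewrite mulrA [d * _]mulrC ler_wpM2r// subr_ge0 ltW.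
rewrite ler_pM2l// -lee_fin fineK; last by rewrite Vfin// ltW.
apply: le_trans (nneseries_lim_ge n.+1 _); last by move=> *; exact: measure_ge0.
rewrite big_mkord.
rewrite (eq_bigr (fun=> (t - x)%:E)).
  by rewrite sumEFin lee_fin sumr_const card_ord mulr_natl.
move=> k _; rewrite /v setIidr.
  by rewrite lebesgue_measure_itv/= lte_fin xt.
move=> y /=; rewrite in_itv/= => /andP[xy yt].
apply: rO; rewrite /ball/= distrC ger0_norm ?subr_ge0 1?ltW//.
by rewrite ltrBlDl (le_lt_trans yt).
Unshelve. all: by end_near. Qed.

Lemma right_increment_le (R : realType) (f : R -> R) (x l e : R) :
  is_derive x 1 f l -> 0 < e ->
  \forall t \near x^'+, f t - f x <= (l + e) * (t - x).
Proof.
move=> [df fl] e0.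
have : h^-1 *: (f (h *: 1 + x) - f x) @[h --> 0^'] --> l by rewrite -fl.
move=> /cvgr_le - /(_ (l + e)); rewrite ltrDl => /(_ e0).
move=> /nbhs_ballP[r /= r0 rP].
near=> t; have xt : x < t by near: t; exact: nbhs_right_gt.
have tr : t < x + r by near: t; apply: nbhs_right_lt; rewrite ltrDl.
have tx0 : 0 < t - x by rewrite subr_gt0.
have := rP (t - x); rewrite /ball/= sub0r normrN gtr0_norm// ltrBlDl.
move=> /(_ tr); rewrite gt_eqF// => /(_ isT).
rewrite [_ *: 1]mulr1 subrK => h.
by rewrite -ler_pdivrMr// mulrC.
Unshelve. all: by end_near. Qed.

(** The truncation at c makes Num.max h c - c nonnegative, so that it has a
    major function U; then U + c (t - a) - f has nonnegative lower right
    derivatives. *)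
Lemma increment_le_integral_trunc (R : realType) (f h : R -> R) (a b c : R) :
  a < b -> f x @[x --> a^'+] --> f a -> f x @[x --> b^'-] --> f b ->
  (forall x, a < x < b -> is_derive x 1 f (h x)) ->
  mu.-integrable `[a, b] (EFin \o h) ->
  f b - f a <= \int[mu]_(x in `[a, b]) Num.max (h x) c.
Proof.
move=> ab fa fb fh hi.
have mh : measurable_fun `[a, b] h.
  by apply/measurable_EFinP; case/integrableP: hi.
have mba : mu `[a, b] = (b - a)%:E.
  by rewrite lebesgue_measure_itv/= lte_fin ab.
have ci (d : R) : mu.-integrable `[a, b] (EFin \o cst d).
  apply: continuous_compact_integrable; first exact: segment_compact.
  exact: cst_continuous.
have hci : mu.-integrable `[a, b] (EFin \o (fun x => Num.max (h x) c)).
  have := integrableD _ (integrable_abse hi) (integrable_abse (ci c)).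
  move=> /(_ (measurable_itv _)).
  apply: le_integrable => //.
    by apply/measurable_EFinP; exact: measurable_maxr.
  move=> x _ /=; rewrite lee_fin [leRHS]ger0_norm ?addr_ge0//.
  by rewrite maxEle; case: ifPn; rewrite ?lerDl ?lerDr.
have gi : mu.-integrable `[a, b] (EFin \o (fun x => Num.max (h x) c - c)).
  exact: (integrableB _ hci (ci c)).
apply/ler_addgt0Pr => e e0.
have g0 x : a <= x <= b -> 0 <= Num.max (h x) c - c.
  by rewrite subr_ge0 le_max lexx orbT.
have [U [Ua Ub Umono Ugrow]] := major_function ab e0 g0 gi.
have : U b <= \int[mu]_(x in `[a, b]) Num.max (h x) c + e - c * (b - a).
  move: Ub; rewrite RintegralB//; last exact: ci.
  rewrite Rintegral_cst; last exact: measurable_itv.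
  rewrite [X in fine X](_ : _ = (b - a)%:E)//= => Ub.
  by apply: (le_trans Ub); rewrite addrAC.
pose G t := U t + c * (t - a) - f t.
suff : G a <= G b.
  by rewrite /G Ua subrr; lra.
have lin (x : R) : c * (t - a) @[t --> x] --> c * (x - a).
  by apply: cvgM; [exact: cvg_cst|apply: cvgB; [exact: cvg_id|exact: cvg_cst]].
have fl x : a < x <= b -> f t @[t --> x^'-] --> f x.
  move=> /andP[ax]; rewrite le_eqVlt => /predU1P[->//|xb].
  have [df _] := fh x (introT andP (conj ax xb)).
  apply: cvg_at_left_filter; apply: differentiable_continuous.
  exact/derivable1_diffP.
apply: (dini_ge0_le ab).
- move=> d d0.
  have d2 : 0 < d / 2 by rewrite divr_gt0.
  near=> t.
  have at_ : a < t by near: t; exact: nbhs_right_gt.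
  have tb : t <= b by near: t; exact: nbhs_right_le.
  have : f t <= f a + d / 2 by near: t; apply: (cvgr_le _ fa); rewrite ltrDl.
  have : - (d / 2) <= c * (t - a).
    near: t; apply: (cvgr_ge _ (cvg_at_right_filter (lin a))).
    by rewrite subrr mulr0 oppr_lt0.
  have := Umono a t (lexx _) (ltW at_) tb.
  by rewrite /G Ua subrr; lra.
- move=> x d xab d0; have /andP[ax xb] := xab.
  have d2 : 0 < d / 2 by rewrite divr_gt0.
  near=> t.
  have at_ : a <= t by near: t; exact: nbhs_left_ge.
  have tx : t <= x by near: t; exact: nbhs_left_le.
  have : f x - d / 2 <= f t.
    by near: t; apply: (cvgr_ge _ (fl _ xab)); rewrite gtrBl.
  have : c * (t - a) <= c * (x - a) + d / 2.
    near: t; apply: (cvgr_le _ (cvg_at_left_filter (lin x))).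
    by rewrite ltrDl.
  have := Umono t x at_ tx xb.
  by rewrite /G; lra.
- move=> x d xab d0; near=> t.
  have xt : x < t by near: t; exact: nbhs_right_gt.
  have : (Num.max (h x) c - c) * (t - x) <= U t - U x by near: t; exact: Ugrow.
  have : f t - f x <= (h x + d) * (t - x).
    by near: t; apply: right_increment_le => //; exact: fh.
  have : h x * (t - x) <= Num.max (h x) c * (t - x).
    by rewrite ler_pM2r ?subr_gt0// le_max lexx.
  by rewrite /G; lra.
Unshelve. all: by end_near. Qed.

Lemma increment_le_integral (R : realType) (f h : R -> R) (a b : R) :
  a < b -> f x @[x --> a^'+] --> f a -> f x @[x --> b^'-] --> f b ->
  (forall x, a < x < b -> is_derive x 1 f (h x)) ->
  mu.-integrable `[a, b] (EFin \o h) ->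
  f b - f a <= \int[mu]_(x in `[a, b]) h x.
Proof.
move=> ab fa fb fh hi.
have mh : measurable_fun `[a, b] h.
  by apply/measurable_EFinP; case/integrableP: hi.
pose hn (n : nat) x := (Num.max (h x) (- n%:R))%:E.
have mhn n : measurable_fun `[a, b] (hn n).
  by apply/measurable_EFinP; exact: measurable_maxr.
have hn_cvg : {ae mu, forall x, `[a, b]%classic x ->
    hn n x @[n --> \oo] --> (h x)%:E}.
  apply: aeW => x _; apply: cvg_near_cst.
  exists (Num.truncn `|h x|).+1 => // n /= hxn; congr EFin.
  apply/max_idPl; rewrite lerNl (le_trans (ler_norm _))// normrN.
  by rewrite (le_trans (ltW (truncnS_gt _)))// ler_nat.
have hn_dom : {ae mu, forall x n, `[a, b]%classic x ->
    (`|hn n x| <= `|(h x)%:E|)%E}.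
  apply: aeW => x n _; rewrite lee_fin maxEle; case: ifPn => // hx.
  rewrite normrN (ger0_norm (ler0n R n)) lerNr in hx *.
  by rewrite (le_trans hx)// -normrN ler_norm.
have [_ _ hn_int] := @dominated_convergence _ _ R mu `[a, b]%classic
  (measurable_itv _) hn (EFin \o h) (abse \o (EFin \o h)) mhn
  (measurable_int _ hi) hn_cvg (integrable_abse hi) hn_dom.
have /fine_cvgP[_ {}hn_int] :
    (\int[mu]_(x in `[a, b]) hn n x)%E @[n --> \oo] -->
    (\int[mu]_(x in `[a, b]) h x)%:E.
  have hfin : (\int[mu]_(x in `[a, b]) (h x)%:E)%E \is a fin_num.
    by apply: integrable_fin_num.
  by rewrite /Rintegral fineK.
rewrite -(cvg_lim _ hn_int)//; apply: limr_ge; first exact: (cvgP _ hn_int).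
apply: nearW => n; exact: (increment_le_integral_trunc _ ab fa fb fh hi).
Qed.

Lemma is_deriveN1 (R : realType) (f : R -> R) (x l : R) :
  is_derive x 1 f l -> is_derive x 1 (fun t => - f t) (- l).
Proof. by move=> ?; exact: is_deriveN. Qed.

(** The majorization above, applied to f and to - f.  The boundary values are
    the limits l and r from inside, so that intervals can be glued at jumps
    of f. *)
Lemma integral_derivative (R : realType) (f h : R -> R) (a b l r : R) :
  a < b -> f x @[x --> a^'+] --> l -> f x @[x --> b^'-] --> r ->
  (forall x, a < x < b -> is_derive x 1 f (h x)) ->
  mu.-integrable `[a, b] (EFin \o h) ->
  \int[mu]_(x in `[a, b]) h x = r - l.
Proof.
move=> ab fa fb fh hi.
(* The limits are made the values at the endpoints. *)
pose F x := if x <= a then l else if b <= x then r else f x.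
have Fa : F x @[x --> a^'+] --> F a.
  rewrite {2}/F lexx; apply: cvg_trans fa; apply: near_eq_cvg; near=> x.
  have ax : a < x by near: x; exact: nbhs_right_gt.
  have xb : x < b by near: x; exact: nbhs_right_lt.
  by rewrite /F !leNgt ax xb.
have Fb : F x @[x --> b^'-] --> F b.
  rewrite {2}/F lexx leNgt ab/=; apply: cvg_trans fb; apply: near_eq_cvg.
  near=> x.
  have ax : a < x by near: x; exact: nbhs_left_gt.
  have xb : x < b by near: x; exact: nbhs_left_lt.
  by rewrite /F !leNgt ax xb.
have Fh x : a < x < b -> is_derive x 1 F (h x).
  move=> xab; have xin : x \in `]a, b[ by rewrite in_itv.
  apply: (near_eq_is_derive _ (fh x xab)).
  near=> y; rewrite /F !leNgt.
  have : y \in `]a, b[ by near: y; exact: near_in_itvoo.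
  by rewrite in_itv/= => /andP[-> ->].
have Fr : F b = r by rewrite /F lexx leNgt ab.
have Fl : F a = l by rewrite /F lexx.
suff : \int[mu]_(x in `[a, b]) h x = F b - F a by rewrite Fr Fl.
apply/eqP; rewrite eq_le.
rewrite (increment_le_integral ab Fa Fb Fh hi) andbT.
have hNi : mu.-integrable `[a, b] (EFin \o (fun x => - h x)).
  exact: (integrableN hi).
have := increment_le_integral ab (cvgN Fa) (cvgN Fb)
  (fun x xab => is_deriveN1 (Fh x xab)) hNi.
have -> : \int[mu]_(x in `[a, b]) - h x = - \int[mu]_(x in `[a, b]) h x.
  rewrite -mulN1r -RintegralZl//.
  by apply: eq_Rintegral => x _; rewrite mulN1r.
by rewrite lerNr opprD !opprK; apply.
Unshelve. all: by end_near. Qed.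

Lemma Rintegral_itv_split (R : realType) (h : R -> R) (a b c : R) :
  a <= c <= b -> mu.-integrable `[a, b] (EFin \o h) ->
  \int[mu]_(x in `[a, b]) h x =
  \int[mu]_(x in `[a, c]) h x + \int[mu]_(x in `[c, b]) h x.
Proof.
move=> /andP[ac cb] hi.
rewrite -[LHS](subrK (\int[mu]_(x in `[a, c]) h x)) addrC.
rewrite Rintegral_itvB ?bnd_simp//; congr (_ + _).
rewrite Rintegral_itv_obnd_cbnd//; apply: integrableS hi => //.
by apply: subset_itvr; rewrite bnd_simp.
Qed.

(** At the points of s the function is continuous, so both pieces of the
    interval see the same boundary value there. *)
Lemma integral_derivative_kinks (R : realType) (f h : R -> R) (s : seq R)
    (a b l r : R) :
  a < b -> f x @[x --> a^'+] --> l -> f x @[x --> b^'-] --> r ->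
  (forall x, a < x < b -> f y @[y --> x] --> f x) ->
  (forall x, a < x < b -> x \notin s -> is_derive x 1 f (h x)) ->
  mu.-integrable `[a, b] (EFin \o h) ->
  \int[mu]_(x in `[a, b]) h x = r - l.
Proof.
elim: s a b l r => [|c s IH] a b l r ab fa fb fc fh hi.
  exact: (integral_derivative ab fa fb (fun x xab => fh x xab isT) hi).
have [/andP[ac cb]|cab] := boolP (a < c < b); last first.
  apply: IH => // x xab xs; apply: fh => //; rewrite inE negb_or xs andbT.
  by apply: contraNneq cab => <-.
have aci : mu.-integrable `[a, c] (EFin \o h).
  by apply: integrableS hi => //; apply: subset_itvl; rewrite bnd_simp ltW.
have cbi : mu.-integrable `[c, b] (EFin \o h).
  by apply: integrableS hi => //; apply: subset_itvr; rewrite bnd_simp ltW.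
have fcc : f y @[y --> c] --> f c by apply: fc; rewrite ac.
have left_part : \int[mu]_(x in `[a, c]) h x = f c - l.
  apply: IH => //.
  - exact: cvg_at_left_filter.
  - by move=> x /andP[ax xc]; apply: fc; rewrite ax (lt_trans xc).
  - move=> x /andP[ax xc] xs; apply: fh; first by rewrite ax (lt_trans xc).
    by rewrite inE negb_or xs lt_eqF.
have right_part : \int[mu]_(x in `[c, b]) h x = r - f c.
  apply: IH => //.
  - exact: cvg_at_right_filter.
  - by move=> x /andP[cx xb]; apply: fc; rewrite xb (lt_trans ac).
  - move=> x /andP[cx xb] xs; apply: fh; first by rewrite xb (lt_trans ac).
    by rewrite inE negb_or xs gt_eqF.
rewrite (@Rintegral_itv_split _ _ _ _ c) ?ltW ?ac//.
by rewrite left_part right_part addrC addrA subrK.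
Qed.

(** * Functions with finitely many discontinuities *)

(** The one-sided limits bound f near each point, and the segment is
    compact. *)
Lemma bounded_one_sided_limits (R : realType) (f : R -> R) (a b : R) :
  (forall t, a <= t < b -> cvg (f x @[x --> t^'+])) ->
  (forall t, a < t <= b -> cvg (f x @[x --> t^'-])) ->
  [bounded f x | x in `[a, b]].
Proof.
move=> fr fl.
have /compact_near_coveringP := @segment_compact R a b.
move=> /(_ R +oo (fun M x => a <= x <= b -> `|f x| <= M) _) H.
have : \forall M \near +oo, `[a, b] `<=` (fun x => a <= x <= b -> `|f x| <= M).
  apply: H => t /=; rewrite in_itv/= => tab.
  (* The constraint on x makes the claim void on the outer side of an endpoint,
     where f need not have a limit. *)
  have [Ml Pl] : exists M, \forall x \near t^'-, a <= x -> `|f x| <= M.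
    have [at_|ta] := ltP a t; last first.
      exists 0; near=> x => ax.
      have : x < t by near: x; exact: nbhs_left_lt.
      by rewrite ltNge (le_trans ta).
    have /cvg_ex[/= l fl'] := fl t (introT andP (conj at_ (andP tab).2)).
    exists (`|l| + 1).
    have := cvgr_norm_le _ fl' (`|l| + 1); rewrite ltrDl => /(_ _ ltr01).
    by apply: filterS.
  have [Mr Pr] : exists M, \forall x \near t^'+, x <= b -> `|f x| <= M.
    have [tb|bt] := ltP t b; last first.
      exists 0; near=> x => xb.
      have : t < x by near: x; exact: nbhs_right_gt.
      by rewrite ltNge (le_trans xb).
    have /cvg_ex[/= l fr'] := fr t (introT andP (conj (andP tab).1 tb)).
    exists (`|l| + 1).
    have := cvgr_norm_le _ fr' (`|l| + 1); rewrite ltrDl => /(_ _ ltr01).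
    by apply: filterS.
  have Ml' : \forall x \near t, x < t -> a <= x -> `|f x| <= Ml by [].
  have Mr' : \forall x \near t, t < x -> x <= b -> `|f x| <= Mr by [].
  near=> x M => /=; move=> /andP[ax xb].
  have [xt|tx|->] := ltgtP x t.
  - apply: (@le_trans _ _ Ml); last first.
      by near: M; apply: nbhs_pinfty_ge; exact: num_real.
    by move: xt ax; near: x.
  - apply: (@le_trans _ _ Mr); last first.
      by near: M; apply: nbhs_pinfty_ge; exact: num_real.
    by move: tx xb; near: x.
  - by near: M; apply: nbhs_pinfty_ge; exact: num_real.
move=> /filter_ex[M HM]; exists M; split; first exact: num_real.
move=> M' MM' x /= xab; apply: le_trans (ltW MM').
by apply: HM => //; move: xab; rewrite in_itv.
Unshelve. all: by end_near. Qed.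

(** A finite set of discontinuities does not affect measurability, whatever the
    values there: all subsets of a countable set are Borel. *)
Lemma measurable_fun_off_finite (R : realType) (f : R -> R) (S : set R)
    (a b : R) :
  finite_set S -> (forall t, a < t < b -> ~ S t -> f x @[x --> t] --> f t) ->
  measurable_fun `[a, b] f.
Proof.
move=> finS fc.
pose V := `]a, b[ `\` S.
have mV : measurable V.
  apply: measurableD; first exact: measurable_itv.
  apply: countable_measurable => [t|]; first exact: measurable_set1.
  exact: finite_set_countable.
have cV : countable (`[a, b] `\` V).
  apply: (@sub_countable _ _ _ (S `|` [set a; b])); last first.
    by apply: finite_set_countable; rewrite !finite_setU.
  apply: subset_card_le => x [/=]; rewrite in_itv/= => /andP[ax xb].
  move=> /not_andP[/negP|/contrapT]; last by left.
  rewrite in_itv/= negb_and -!leNgt => /orP[xa|bx]; right.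
    by left; apply/eqP; rewrite eq_le xa.
  by right; apply/eqP; rewrite eq_le xb.
have -> : `[a, b]%classic = V `|` (`[a, b] `\` V).
  rewrite setDUK// => x [/=]; rewrite !in_itv/= => /andP[ax xb] _.
  by rewrite !ltW.
apply/measurable_funU => //.
  by apply: measurableD => //; exact: measurable_itv.
split.
  apply: subspace_continuous_measurable_fun => //.
  apply: continuous_in_subspaceT => x; rewrite inE => -[/=].
  by rewrite in_itv/= => xab Sx; exact: fc.
move=> _ Y mY; apply: countable_measurable => [t|].
  exact: measurable_set1.
by apply: sub_countable cV; apply: subset_card_le; exact: subIsetl.
Qed.

(** The pieces between consecutive jump times are glued; each jump time
    contributes the difference gp k - gm k of its two one-sided limits. *)
Lemma integral_derivative_jumps (R : realType) (g h : R -> R) (s : seq R)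
    (tau : nat -> R) (gp gm : nat -> R) (N : nat) (b r : R) :
  {homo tau : i j / (i < j)%N >-> i < j} -> tau N < b ->
  (forall k, (k <= N)%N -> g x @[x --> (tau k)^'+] --> gp k) ->
  (forall k, (0 < k <= N)%N -> g x @[x --> (tau k)^'-] --> gm k) ->
  g x @[x --> b^'-] --> r ->
  (forall t, tau 0 < t < b -> (forall k, (0 < k <= N)%N -> t != tau k) ->
    g x @[x --> t] --> g t) ->
  (forall t, tau 0 < t < b -> (forall k, (0 < k <= N)%N -> t != tau k) ->
    t \notin s -> is_derive t 1 g (h t)) ->
  mu.-integrable `[tau 0, b] (EFin \o h) ->
  \int[mu]_(t in `[tau 0, b]) h t =
  r - gp 0 - \sum_(1 <= k < N.+1) (gp k - gm k).
Proof.
move=> tauI; elim: N b r => [|N IH] b r Nb gpP gmP gb gc gd hi.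
  rewrite big_geq// subr0; apply: (@integral_derivative_kinks _ g _ s) => //.
  - exact: gpP.
  - by move=> x xab; apply: gc => //; case.
  - by move=> x xab xs; apply: gd => //; case.
set c := tau N.+1.
have ac : tau 0 < c by exact: tauI.
have Nc : tau N < c by exact: tauI.
have aci : mu.-integrable `[tau 0, c] (EFin \o h).
  by apply: integrableS hi => //; apply: subset_itvl; rewrite bnd_simp ltW.
have cbi : mu.-integrable `[c, b] (EFin \o h).
  by apply: integrableS hi => //; apply: subset_itvr; rewrite bnd_simp ltW.
have neN t : t < c -> (forall k, (0 < k <= N)%N -> t != tau k) ->
    forall k, (0 < k <= N.+1)%N -> t != tau k.
  move=> tc tN k /andP[k0]; rewrite leq_eqVlt => /predU1P[->|kN].
    by rewrite lt_eqF.
  by apply: tN; rewrite k0.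
have left_part : \int[mu]_(t in `[tau 0, c]) h t =
    gm N.+1 - gp 0 - \sum_(1 <= k < N.+1) (gp k - gm k).
  apply: IH => //.
  - by move=> k kN; apply: gpP; exact: leqW.
  - by move=> k /andP[k0 kN]; apply: gmP; rewrite k0 leqW.
  - by apply: (gmP N.+1); rewrite /= leqnn.
  - move=> t /andP[at_ tc] tN; apply: gc; first by rewrite at_ (lt_trans tc).
    exact: (neN t tc tN).
  - move=> t /andP[at_ tc] tN ts; apply: gd => //.
      by rewrite at_ (lt_trans tc).
    exact: (neN t tc tN).
have neN' t : c < t -> forall k, (0 < k <= N.+1)%N -> t != tau k.
  move=> ct k /andP[_ kN]; rewrite gt_eqF// (le_lt_trans _ ct)//.
  by move: kN; rewrite leq_eqVlt => /predU1P[->//|/tauI/ltW].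
have right_part : \int[mu]_(t in `[c, b]) h t = r - gp N.+1.
  apply: (@integral_derivative_kinks _ g _ s) => //.
  - exact: gpP.
  - move=> t /andP[ct tb]; apply: gc; first by rewrite tb (lt_trans ac).
    exact: (neN' t ct).
  - move=> t /andP[ct tb] ts; apply: gd => //.
      by rewrite tb (lt_trans ac).
    exact: (neN' t ct).
rewrite (@Rintegral_itv_split _ _ _ _ c) ?ltW ?ac//.
rewrite [in RHS]big_nat_recr//= left_part right_part; ring.
Qed.

(** * The inner product of matrices and the state block *)

Section MatrixInnerProduct.
Local Open Scope sesquilinear_scope.
Variable R : realType.
Local Notation C := R[i].

Lemma ReMconj (x y : C) : Re (x * y^*) = Re x * Re y + Im x * Im y.
Proof. by case: x y => [a b] [c d] /=; rewrite mulrN opprK. Qed.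

(** In coordinates the inner product is a real bilinear form, which reduces its
    limits, derivatives and integrals to those of real functions. *)
Lemma mxdotE p (A B : 'M[C]_p) : mxdot A B =
  \sum_i \sum_j (Re (A i j) * Re (B i j) + Im (A i j) * Im (B i j)).
Proof.
rewrite /mxdot /mxtrace raddf_sum; apply: eq_bigr => i _.
rewrite mxE raddf_sum; apply: eq_bigr => j _.
by rewrite !mxE; exact: ReMconj.
Qed.

Lemma mxdotDl p (A B D : 'M[C]_p) : mxdot (A + B) D = mxdot A D + mxdot B D.
Proof. by rewrite /mxdot mulmxDl !raddfD. Qed.

Lemma mxdotBl p (A B D : 'M[C]_p) : mxdot (A - B) D = mxdot A D - mxdot B D.
Proof. by rewrite /mxdot mulmxBl !raddfB. Qed.

Lemma mxdot0l p (A : 'M[C]_p) : mxdot 0 A = 0.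
Proof. by rewrite /mxdot mul0mx raddf0. Qed.

Lemma state_blockE n m (X : 'M[C]_(n + m)) : state_block X = ulsubmx X.
Proof.
rewrite /state_block /state_proj -{1}(submxK X).
rewrite mul_row_block !mul1mx !mul0mx !addr0.
rewrite tr_row_mx trmx1 trmx0 map_col_mx map_mx1 map_mx0.
by rewrite mul_row_col mulmx1 mulmx0 addr0.
Qed.

Lemma adjmxK p q (A : 'M[C]_(p, q)) : A ^t* ^t* = A.
Proof. by apply/matrixP => i j; rewrite !mxE conjCK. Qed.

Lemma adjmxM p q r (A : 'M[C]_(p, q)) (B : 'M[C]_(q, r)) :
  (A *m B) ^t* = B ^t* *m A ^t*.
Proof. by rewrite trmx_mul map_mxM. Qed.

(** Cyclicity of the trace: A |-> E^* A E is the adjoint of the state block. *)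
Lemma mxdot_state_proj n m (A : 'M[C]_n) (X : 'M[C]_(n + m)) :
  mxdot ((state_proj R n m) ^t* *m A *m state_proj R n m) X =
  mxdot A (state_block X).
Proof.
rewrite /mxdot /state_block !adjmxM adjmxK -!mulmxA mxtrace_mulC.
by rewrite -!mulmxA.
Qed.

End MatrixInnerProduct.

(** * Limits and derivatives of inner products *)

Section MatrixCalculus.
Variables (R : realType) (p : nat).
Local Notation C := R[i].
Implicit Types (f g : R -> 'M[C]_p) (A B : 'M[C]_p) (G : set_system R).

Lemma mxcvg_to_mxdot G f g A B : Filter G -> mxcvg_to G f A -> mxcvg_to G g B ->
  mxdot (f t) (g t) @[t --> G] --> mxdot A B.
Proof.
move=> FG fA gB; under eq_fun do rewrite mxdotE; rewrite mxdotE.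
apply: cvg_big => [|i _]; first exact: add_continuous.
apply: cvg_big => [|j _]; first exact: add_continuous.
have [fr fi] := fA i j; have [gr gi] := gB i j.
by apply: cvgD; exact: cvgM.
Qed.

Lemma mxcvg_to_mxlim G f A : ProperFilter G -> mxcvg_to G f A -> mxlim G f = A.
Proof.
move=> FG fA; apply/matrixP => i j; rewrite mxE.
have [/cvg_lim -> // /cvg_lim -> //] := fA i j.
by case: (A i j).
Qed.

Lemma mxcvgP G f : ProperFilter G -> mxcvg G f -> mxcvg_to G f (mxlim G f).
Proof. by move=> FG [A fA]; rewrite (mxcvg_to_mxlim FG fA). Qed.

Lemma mxcvg_to_filter G H f A : G `=>` H -> mxcvg_to H f A -> mxcvg_to G f A.
Proof.
by move=> GH fA i j; have [fr fi] := fA i j; split; apply: cvg_trans;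
  [exact: cvg_app GH|exact: fr|exact: cvg_app GH|exact: fi].
Qed.

Lemma mxderivable_cvg f t : mxderivable f t -> mxcvg_to (nbhs t) f (f t).
Proof.
by move=> df i j; have [dr di] := df i j; split;
  apply: differentiable_continuous; apply/derivable1_diffP.
Qed.

Lemma is_derive_mxdot f g t : mxderivable f t -> mxderivable g t ->
  is_derive t 1 (fun s => mxdot (f s) (g s))
    (mxdot (mxderive f t) (g t) + mxdot (f t) (mxderive g t)).
Proof.
move=> df dg.
have -> : (fun s => mxdot (f s) (g s)) = \sum_i \sum_j
    (mxre f i j * mxre g i j + mxim f i j * mxim g i j).
  apply/funext => s; rewrite mxdotE fct_sumE; apply: eq_bigr => i _.
  by rewrite fct_sumE; apply: eq_bigr.
have entry i j :
    is_derive t 1 (mxre f i j * mxre g i j + mxim f i j * mxim g i j)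
      ((derive1 (mxre f i j) t * Re (g t i j) +
        derive1 (mxim f i j) t * Im (g t i j)) +
       (Re (f t i j) * derive1 (mxre g i j) t +
        Im (f t i j) * derive1 (mxim g i j) t)).
  have [fr fi] := df i j; have [gr gi] := dg i j.
  have := is_deriveD (is_deriveM (derivableP fr) (derivableP gr))
    (is_deriveM (derivableP fi) (derivableP gi)).
  move=> /is_derive_eq; apply; rewrite !derive1E /mxre /mxim /GRing.scale/=.
  ring.
apply: is_derive_eq (is_derive_sum (fun i => is_derive_sum (entry i))) _.
rewrite !mxdotE -big_split; apply: eq_bigr => i _.
by rewrite -big_split; apply: eq_bigr => j _; rewrite !mxE.
Qed.

End MatrixCalculus.

(** * Hermitian matrices as a real vector space *)

Section Hermitian.
Variable R : realType.
Local Notation C := R[i].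

Lemma hermsymmxE p (A : 'M[C]_p) :
  A \is hermsymmx <-> forall i j, A i j = (A j i)^*.
Proof.
split=> [/is_hermitianmxP|AE].
  by rewrite expr0 scale1r => AE i j; rewrite {1}AE !mxE.
apply/is_hermitianmxP; rewrite expr0 scale1r.
by apply/matrixP => i j; rewrite AE !mxE.
Qed.

Lemma hermsymmx_cvg p (G : set_system R) (f : R -> 'M[C]_p) (A : 'M[C]_p) :
  ProperFilter G -> mxcvg_to G f A ->
  (\forall t \near G, f t \is hermsymmx) -> A \is hermsymmx.
Proof.
move=> FG fA fh; apply/hermsymmxE => i j.
have [fr fi] := fA i j; have [gr gi] := fA j i.
have fre : \forall t \near G, mxre f j i t = mxre f i j t.
  apply: filterS fh => t /hermsymmxE ft; rewrite /mxre [f t i j]ft.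
  by case: (f t j i).
have fim : \forall t \near G, - mxim f j i t = mxim f i j t.
  apply: filterS fh => t /hermsymmxE ft; rewrite /mxim [f t i j]ft.
  by case: (f t j i).
have frE : mxre f i j @ G --> Re (A j i).
  by apply: cvg_trans gr; exact: near_eq_cvg.
have fiE : mxim f i j @ G --> - Im (A j i).
  by apply: cvg_trans (cvgN gi); exact: near_eq_cvg.
have Er : Re (A i j) = Re (A j i) by rewrite -(cvg_lim _ fr)// (cvg_lim _ frE).
have Ei : Im (A i j) = - Im (A j i).
  by rewrite -(cvg_lim _ fi)// (cvg_lim _ fiE).
by case: (A i j) (A j i) Er Ei => [a b] [c d] /= -> ->.
Qed.

Lemma hermsymmxD p (A B : 'M[C]_p) :
  A \is hermsymmx -> B \is hermsymmx -> A + B \is hermsymmx.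
Proof.
move=> /hermsymmxE AE /hermsymmxE BE; apply/hermsymmxE => i j.
by rewrite !mxE [A i j]AE [B i j]BE rmorphD.
Qed.

Lemma hermsymmxZ p (a : R) (A : 'M[C]_p) :
  A \is hermsymmx -> a%:C%C *: A \is hermsymmx.
Proof.
move=> /hermsymmxE AE; apply/hermsymmxE => i j.
by rewrite !mxE [A i j]AE rmorphM; congr (_ * _); exact: (esym (conjc_real a)).
Qed.

Lemma hermsymmx0 p : (0 : 'M[C]_p) \is hermsymmx.
Proof. by apply/hermsymmxE => i j; rewrite !mxE rmorph0. Qed.

(** A Hermitian operator is additive and homogeneous over the reals only, and on
    Hermitian matrices only, so partial sums must be kept Hermitian. *)
Lemma herm_operator_sum p q (L : 'M[C]_p -> 'M[C]_q) (I : Type) (s : seq I)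
    (a : I -> R) (A : I -> 'M[C]_p) :
  herm_operator L -> (forall k, A k \is hermsymmx) ->
  L (\sum_(k <- s) (a k)%:C%C *: A k) = \sum_(k <- s) (a k)%:C%C *: L (A k).
Proof.
move=> [_ Llin _] Ah.
have sumh r : \sum_(k <- r) (a k)%:C%C *: A k \is hermsymmx.
  apply: (big_ind (fun M => M \is hermsymmx)); [exact: hermsymmx0|..].
    by move=> *; exact: hermsymmxD.
  by move=> k _; exact: hermsymmxZ.
elim: s => [|k s IH]; last by rewrite !big_cons Llin// IH.
rewrite !big_nil; have := Llin 1 _ _ (hermsymmx0 p) (hermsymmx0 p).
rewrite !scale1r addr0 => /(congr1 (fun M => M - L 0)).
by rewrite subrr addrK.
Qed.

(** The matrices (E_ij + E_ji) / 2 and i (E_ij - E_ji) / 2.  They span the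
    Hermitian matrices over the reals redundantly, but the coordinates of A in
    them are simply the real and imaginary parts of the entries of A. *)
Definition herm_gen p (k : bool * ('I_p * 'I_p)) : 'M[C]_p :=
  let: (b, (i, j)) := k in
  if b then (0 +i* 2^-1)%C *: (delta_mx i j - delta_mx j i)
  else (2^-1)%:C%C *: (delta_mx i j + delta_mx j i).

Definition herm_coord p (k : bool * ('I_p * 'I_p)) (A : 'M[C]_p) : R :=
  let: (b, (i, j)) := k in if b then Im (A i j) else Re (A i j).

Lemma hermsymmx_gen p k : @herm_gen p k \is hermsymmx.
Proof.
have conji (x : R) : ((0 +i* x)%C : C)^* = - (0 +i* x)%C.
  by apply/eqP; rewrite eq_complex/= oppr0 !eqxx.
case: k => -[] [i j]; last first.
  apply: hermsymmxZ; apply/hermsymmxE => k l; rewrite !mxE rmorphD !rmorph_nat.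
  by rewrite addrC [(l == i) && _]andbC [(l == j) && _]andbC.
apply/hermsymmxE => k l; rewrite !mxE rmorphM /= conji rmorphB !rmorph_nat.
by rewrite mulNr -mulrN opprB [(l == i) && _]andbC [(l == j) && _]andbC.
Qed.

(** The two terms of index (i, j) add up to half the sum of A i j *: E_ij and
    its adjoint, so that the total is (A + A^* ) / 2 = A. *)
Lemma herm_expansion p (A : 'M[C]_p) : A \is hermsymmx ->
  A = \sum_k (herm_coord k A)%:C%C *: herm_gen k.
Proof.
move=> /hermsymmxE AE.
pose f b i j := (herm_coord (b, (i, j)) A)%:C%C *: herm_gen (b, (i, j)).
have -> : \sum_k (herm_coord k A)%:C%C *: herm_gen k =
    \sum_i \sum_j (f true i j + f false i j).
  rewrite (eq_bigr (fun k => f k.1 k.2.1 k.2.2)); last by case=> b [i j].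
  rewrite -(pair_bigA _ (fun b ij => f b ij.1 ij.2))/= big_bool/= -big_split/=.
  by rewrite -(pair_bigA _ (fun i j => f true i j + f false i j)).
pose h : C := (2^-1)%:C%C.
have termE i j : f true i j + f false i j =
    h *: (A i j *: delta_mx i j) + h *: (A j i *: delta_mx j i).
  rewrite /f/= [A j i]AE !scalerA scalerBr scalerDr addrACA -scalerDl -scaleNr.
  rewrite -scalerDl; congr (_ *: _ + _ *: _); case: (A i j) => x y; apply/eqP;
    rewrite eq_complex/=; apply/andP; split; apply/eqP; ring.
under eq_bigr => i _.
  under eq_bigr => j _ do rewrite termE.
  rewrite big_split/=.
  over.
have deltaE : \sum_i \sum_j h *: (A i j *: delta_mx i j) = h *: A.
  rewrite [in RHS](matrix_sum_delta A) scaler_sumr.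
  by apply: eq_bigr => i _; rewrite scaler_sumr.
rewrite big_split/= [X in _ + X]exchange_big/= !deltaE -scalerDl.
have -> : h + h = 1.
  by apply/eqP; rewrite eq_complex/= addr0 eqxx andbT [eqbRHS]splitr mul1r.
by rewrite scale1r.
Qed.

End Hermitian.

(** * Integrability along a trajectory *)

Lemma integrable_bounded_mul (R : realType) (a b : R) (h k : R -> R) :
  measurable_fun `[a, b] h -> [bounded h x | x in `[a, b]] ->
  mu.-integrable `[a, b] (EFin \o k) ->
  mu.-integrable `[a, b] (fun t => ((h t)%:E * (k t)%:E)%E).
Proof. by move=> mh bh ik; apply: integrableMr. Qed.

Section Integrability.
Variables (R : realType) (p : nat).
Local Notation C := R[i].
Implicit Types (f g : R -> 'M[C]_p) (a b : R).

Definition mxbounded_measurable a b f : Prop := forall i j,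
  (measurable_fun `[a, b] (mxre f i j) /\
   [bounded mxre f i j x | x in `[a, b]]) /\
  (measurable_fun `[a, b] (mxim f i j) /\
   [bounded mxim f i j x | x in `[a, b]]).

Lemma integrable_mxdot a b f g :
  mxbounded_measurable a b f -> mxintegrable a b g ->
  mu.-integrable `[a, b] (fun t => (mxdot (f t) (g t))%:E).
Proof.
move=> ft gi.
have -> : (fun t => (mxdot (f t) (g t))%:E) = (fun t => \sum_i \sum_j
    ((mxre f i j t)%:E * (mxre g i j t)%:E +
     (mxim f i j t)%:E * (mxim g i j t)%:E))%E.
  apply/funext => t; rewrite mxdotE -sumEFin; apply: eq_bigr => i _.
  by rewrite -sumEFin; apply: eq_bigr => j _.
apply: integrable_sum => // i _; apply: integrable_sum => // j _.
have [[fr fR] [fi fI]] := ft i j; have [gr gI] := gi i j.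
have rr := integrable_bounded_mul fr fR gr.
have ii := integrable_bounded_mul fi fI gI.
exact: (integrableD _ rr ii).
Qed.

Lemma continuous_measurable_bounded a b (h : R -> R) :
  {within `[a, b], continuous h} ->
  measurable_fun `[a, b] h /\ [bounded h x | x in `[a, b]].
Proof.
move=> hc; split.
  by apply: subspace_continuous_measurable_fun => //; exact: measurable_itv.
have /compact_bounded[M [_ mrt]] :=
  continuous_compact hc (@segment_compact _ a b).
by exists M; split; rewrite ?num_real // => ? ? ? ?; exact: mrt.
Qed.

Lemma one_sided_limits_bounded_measurable a b (S : set R) f : finite_set S ->
  (forall t, a < t < b -> ~ S t -> mxcvg_to (nbhs t) f (f t)) ->
  (forall t, a <= t < b -> mxcvg t^'+ f) ->
  (forall t, a < t <= b -> mxcvg t^'- f) ->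
  mxbounded_measurable a b f.
Proof.
move=> finS fc fr fl i j; split; split.
- apply: (measurable_fun_off_finite finS) => t tab St.
  by have [] := fc t tab St i j.
- apply: bounded_one_sided_limits => t tab.
  + by have [L /(_ i j)[/cvgP]] := fr t tab.
  + by have [L /(_ i j)[/cvgP]] := fl t tab.
- apply: (measurable_fun_off_finite finS) => t tab St.
  by have [] := fc t tab St i j.
- apply: bounded_one_sided_limits => t tab.
  + by have [L /(_ i j)[_ /cvgP]] := fr t tab.
  + by have [L /(_ i j)[_ /cvgP]] := fl t tab.
Qed.

End Integrability.

Lemma mxintegrable_state_block (R : realType) n m (a b : R)
    (X : R -> 'M[R[i]]_(n + m)) :
  mxintegrable a b X -> mxintegrable a b (fun t => state_block (X t)).
Proof.
move=> Xi i j; have [Xr Xim] := Xi (lshift m i) (lshift m j).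
split; [move: Xr|move: Xim]; congr (mu.-integrable _ (EFin \o _));
  by apply/funext => t; rewrite /mxre /mxim state_blockE !mxE.
Qed.

Lemma mxcvg_to_state_block (R : realType) n m (G : set_system R)
    (X : R -> 'M[R[i]]_(n + m)) (L : 'M[R[i]]_(n + m)) :
  mxcvg_to G X L -> mxcvg_to G (fun t => state_block (X t)) (state_block L).
Proof.
move=> XL i j; have [Xr Xim] := XL (lshift m i) (lshift m j).
rewrite (_ : mxre _ i j = mxre X (lshift m i) (lshift m j)); last first.
  by apply/funext => t; rewrite /mxre state_blockE !mxE.
rewrite (_ : mxim _ i j = mxim X (lshift m i) (lshift m j)); last first.
  by apply/funext => t; rewrite /mxim state_blockE !mxE.
by rewrite state_blockE !mxE.
Qed.

(** F is continuous in t for each fixed argument only, while X t varies with t;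
    the expansion of X t in fixed matrices separates the two dependencies. *)
Lemma integrable_herm_operator (R : realType) p q (a b : R)
    (F : R -> 'M[R[i]]_p -> 'M[R[i]]_q) (X : R -> 'M[R[i]]_p) :
  (forall t, a <= t -> herm_operator (F t)) ->
  (forall A, A \is hermsymmx -> forall i j,
    {within `[a, +oo[, continuous (mxre (F ^~ A) i j)} /\
    {within `[a, +oo[, continuous (mxim (F ^~ A) i j)}) ->
  (forall t, a <= t <= b -> X t \is hermsymmx) ->
  mxintegrable a b X -> mxintegrable a b (fun t => F t (X t)).
Proof.
move=> Fherm Fcont Xherm Xi i j.
have FE t : a <= t <= b -> F t (X t) =
    \sum_k (herm_coord k (X t))%:C%C *: F t (herm_gen R k).
  move=> tab; rewrite {1}(herm_expansion (Xherm t tab)).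
  apply: herm_operator_sum; last exact: hermsymmx_gen.
  by apply: Fherm; case/andP: tab.
have coordi k : mu.-integrable `[a, b] (fun t => (herm_coord k (X t))%:E).
  by case: k => -[] [k l]; have [] := Xi k l.
have tame (k : bool * ('I_p * 'I_p)) :
    mxbounded_measurable a b (F ^~ (herm_gen R k)).
  move=> k' l; have [cr ci] := Fcont _ (hermsymmx_gen R k) k' l.
  have sub : `[a, b] `<=` `[a, +oo[.
    by apply: subset_itvl.
  by split; apply: continuous_measurable_bounded;
    [exact: continuous_subspaceW cr|exact: continuous_subspaceW ci].
have ReZ (c : R) (z : R[i]) : Re (c%:C%C * z) = c * Re z.
  by case: z => x y /=; rewrite mul0r subr0.
have ImZ (c : R) (z : R[i]) : Im (c%:C%C * z) = c * Im z.
  by case: z => x y /=; rewrite mul0r addr0.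
split.
- apply: (@eq_integrable _ _ _ mu _ _ (fun t => (\sum_k
      ((mxre (F ^~ (herm_gen R k)) i j t)%:E *
       (herm_coord k (X t))%:E))%E)) => //.
    move=> t; rewrite inE/= in_itv/= => tab.
    rewrite /mxre FE// summxE raddf_sum sumEFin; congr EFin.
    by apply: eq_bigr => k _; rewrite mxE/= mulrC ReZ.
  apply: integrable_sum => // k _; have [[fr fR] _] := tame k i j.
  exact: (integrable_bounded_mul fr fR (coordi k)).
- apply: (@eq_integrable _ _ _ mu _ _ (fun t => (\sum_k
      ((mxim (F ^~ (herm_gen R k)) i j t)%:E *
       (herm_coord k (X t))%:E))%E)) => //.
    move=> t; rewrite inE/= in_itv/= => tab.
    rewrite /mxim FE// summxE raddf_sum sumEFin; congr EFin.
    by apply: eq_bigr => k _; rewrite mxE/= mulrC ImZ.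
  apply: integrable_sum => // k _; have [_ [fi fI]] := tame k i j.
  exact: (integrable_bounded_mul fi fI (coordi k)).
Qed.

(** * The cost identity *)

Theorem proposition3p1 (R : realType) (n m : nat) (n_gt0 : (0 < n)%N)
  (m_gt0 : (0 < m)%N)
  (tau : nat -> R) (tau_jumps : jump_sequence tau)
  (F : R -> 'M[R[i]]_(n + m) -> 'M[R[i]]_n)
  (Fs : R -> 'M[R[i]]_n -> 'M[R[i]]_(n + m))
  (J : nat -> 'M[R[i]]_(n + m) -> 'M[R[i]]_n)
  (Js : nat -> 'M[R[i]]_n -> 'M[R[i]]_(n + m))
  (F_flow : flow_operator (tau 0) F)
  (F_adj : forall t, tau 0 <= t -> adjoint_operator (F t) (Fs t))
  (J_jump : forall k, (0 < k)%N -> jump_operator (J k))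
  (J_adj : forall k, (0 < k)%N -> adjoint_operator (J k) (Js k))
  (X10 : 'M[R[i]]_n) (X10_psd : psdmx X10)
  (T : R) (T_gt0 : 0 < T) (N : nat) (N_count : jump_count tau T N)
  (Z : R -> 'M[R[i]]_(n + m)) (Zk : nat -> 'M[R[i]]_(n + m)) (ZT : 'M[R[i]]_n)
  (Z_psd : forall t, tau 0 <= t <= tau 0 + T -> psdmx (Z t))
  (Zk_psd : forall k, (0 < k <= N)%N -> psdmx (Zk k))
  (ZT_psd : psdmx ZT)
  (P : R -> 'M[R[i]]_n)
  (P_herm : forall t, tau 0 <= t <= tau 0 + T -> P t \is hermsymmx)
  (P_C1 : piecewise_C1 (tau 0) (tau 0 + T) (jump_times tau) P)
  (X : R -> 'M[R[i]]_(n + m)) (X_traj : trajectory tau T F J X10 X)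
  (ZX_int : lebesgue_measure.-integrable `[tau 0, tau 0 + T]
              (fun t => (mxdot (Z t) (X t))%:E)) :
  cost tau T N Z Zk ZT X =
    mxdot (P (tau 0)) X10
    + mxdot (ZT - P (tau 0 + T)) (state_block (X (tau 0 + T)))
    + \int[lebesgue_measure]_(t in `[tau 0, tau 0 + T])
        mxdot (flow_composite Fs Z P t) (X t)
    + \sum_(1 <= k < N.+1)
        mxdot (jump_composite Js Zk k (mxlim (tau k)^'+ P)
                 (mxlim (tau k)^'- P))
              (mxlim (tau k)^'- X)
  /\
  (P (tau 0 + T) = ZT ->
   cost tau T N Z Zk ZT X =
    mxdot (P (tau 0)) X10
    + \int[lebesgue_measure]_(t in `[tau 0, tau 0 + T])
        mxdot (flow_composite Fs Z P t) (X t)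
    + \sum_(1 <= k < N.+1)
        mxdot (jump_composite Js Zk k (mxlim (tau k)^'+ P)
                 (mxlim (tau k)^'- P))
              (mxlim (tau k)^'- X)).
Proof.
move: X_traj => [[X_psd X_int] X10E [X1a X1b] X_ode X_jump].
move: P_C1 => [D finD [[Pa Pb] Pc Pj Pd [dPr dPl]]].
move: tau_jumps F_flow => [tauI _] [F_herm F_cont _].
set b := tau 0 + T in ZX_int X_psd X_int X1b X_ode X_jump N_count Z_psd P_herm
  Pb Pc Pj Pd dPr dPl *.
pose X1 t := state_block (X t).
have ab : tau 0 < b by rewrite /b ltrDl.
have Nb : tau N < b.
  by move: N_count; case: (N) => // k /(_ k.+1 isT) ->; rewrite leqnn.
have tau_in k : (0 < k <= N)%N -> tau 0 < tau k < b.
  by move=> /andP[k0 kN]; rewrite tauI// (N_count k k0).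
have tau_jump k : (0 < k)%N -> jump_times tau (tau k) by move=> k0; exists k.
have no_jump t : t < b -> (forall k, (0 < k <= N)%N -> t != tau k) ->
    ~ jump_times tau t.
  move=> tb tN [k k0 tk]; have kN : (k <= N)%N by rewrite -N_count// -tk.
  by have := tN k; rewrite k0 kN tk eqxx => /(_ isT).
have X_herm t : tau 0 <= t <= b -> X t \is hermsymmx by move=> /X_psd[].
have P_right k : (k <= N)%N -> mxcvg (tau k)^'+ P.
  case: k => [|k] kN; first by exists (P (tau 0)); exact: Pa.
  by have [] := Pj _ (tau_in k.+1 kN) (tau_jump k.+1 isT).
have P_left k : (0 < k <= N)%N -> mxcvg (tau k)^'- P.
  move=> /[dup] /andP[k0 _] kN.
  by have [] := Pj _ (tau_in k kN) (tau_jump k k0).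
have X1_right k : (k <= N)%N -> mxcvg (tau k)^'+ X1.
  case: k => [|k] kN; first by exists (X1 (tau 0)); exact: X1a.
  by have [] := X_jump k.+1 isT (andP (tau_in k.+1 kN)).2.
have X_left k : (0 < k <= N)%N -> mxcvg_to (tau k)^'- X (mxlim (tau k)^'- X).
  move=> /[dup] /andP[k0 _] kN; apply: mxcvgP.
  by have [] := X_jump k k0 (andP (tau_in k kN)).2.
(* The index 0 adds the initial time, which is not inside the horizon. *)
pose S := tau @` `I_N.+1.
have finS : finite_set S by apply: finite_image; exact: finite_II.
have P_cont t : tau 0 < t < b -> (forall k, (0 < k <= N)%N -> t != tau k) ->
    mxcvg_to (nbhs t) P (P t).
  by move=> tab tN; apply: Pc => //; apply: no_jump => //; case/andP: tab.
have offS t : ~ S t -> forall k, (0 < k <= N)%N -> t != tau k.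
  by move=> tS k /andP[_ kN]; apply/eqP => tk; apply: tS; exists k.
have P_bm : mxbounded_measurable (tau 0) b P.
  apply: (one_sided_limits_bounded_measurable finS).
  - by move=> t tab /offS; exact: P_cont.
  - move=> t /andP[]; rewrite le_eqVlt => /predU1P[<- _|at_ tb].
      by exists (P (tau 0)).
    have tab : tau 0 < t < b by rewrite at_.
    have [/(Pj t tab)[]//|tJ] := pselect (jump_times tau t).
    by exists (P t); apply: mxcvg_to_filter (Pc t tab tJ); exact: cvg_within.
  - move=> t /andP[at_]; rewrite le_eqVlt => /predU1P[->|tb].
      by exists (P b).
    have tab : tau 0 < t < b by rewrite at_.
    have [/(Pj t tab)[]//|tJ] := pselect (jump_times tau t).
    by exists (P t); apply: mxcvg_to_filter (Pc t tab tJ); exact: cvg_within.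
have dP_bm : mxbounded_measurable (tau 0) b (mxderive P).
  have finSD : finite_set (S `|` D) by rewrite finite_setU.
  apply: (one_sided_limits_bounded_measurable finSD) => // t tab.
  move=> /not_orP[tS tD].
  have tJ : ~ jump_times tau t by apply: no_jump (offS _ tS); case/andP: tab.
  by have [] := Pd t tab tJ tD.
have X1_int := mxintegrable_state_block X_int.
have FX_int := integrable_herm_operator F_herm F_cont X_herm X_int.
pose h t := mxdot (mxderive P t) (X1 t) + mxdot (P t) (F t (X t)).
have h_int : mu.-integrable `[tau 0, b] (EFin \o h).
  exact: (integrableD _ (integrable_mxdot dP_bm X1_int)
                        (integrable_mxdot P_bm FX_int)).
have [s Ds] : exists s : seq R, D = [set` s] by apply/finite_seqP.
(* At k = 0 the right limits are the initial values. *)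
pose gp k := mxdot (mxlim (tau k)^'+ P) (mxlim (tau k)^'+ X1).
pose gm k := mxdot (mxlim (tau k)^'- P) (mxlim (tau k)^'- X1).
have h_integral : \int[mu]_(t in `[tau 0, b]) h t =
    mxdot (P b) (X1 b) - gp 0 - \sum_(1 <= k < N.+1) (gp k - gm k).
  apply: (@integral_derivative_jumps _ (fun t => mxdot (P t) (X1 t)) _ s) => //.
  - by move=> k kN; apply: mxcvg_to_mxdot; apply: mxcvgP; auto.
  - move=> k kN; apply: mxcvg_to_mxdot; first by apply: mxcvgP; exact: P_left.
    apply: mxcvgP; exists (state_block (mxlim (tau k)^'- X)).
    by apply: mxcvg_to_state_block; exact: X_left.
  - exact: mxcvg_to_mxdot.
  - move=> t tab tN; apply: mxcvg_to_mxdot; first exact: P_cont.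
    apply: mxderivable_cvg.
    by have [] := X_ode t tab (no_jump t (andP tab).2 tN).
  - move=> t tab tN ts; have tJ := no_jump t (andP tab).2 tN.
    have [dX1 dX1E] := X_ode t tab tJ.
    rewrite /h -dX1E; apply: is_derive_mxdot => //.
    have tD : ~ D t by rewrite Ds /= => /(negP ts).
    by have [] := Pd t tab tJ tD.
have flowE : \int[mu]_(t in `[tau 0, b]) mxdot (flow_composite Fs Z P t) (X t) =
    \int[mu]_(t in `[tau 0, b]) h t +
    \int[mu]_(t in `[tau 0, b]) mxdot (Z t) (X t).
  rewrite -RintegralD//; apply: eq_Rintegral => t.
  rewrite inE/= in_itv/= => tab.
  have at_ : tau 0 <= t by case/andP: tab.
  rewrite /flow_composite !mxdotDl mxdot_state_proj.
  by have [_ <-] := F_adj t at_; [|exact: X_herm|exact: P_herm].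
have jumpE k : (0 < k <= N)%N ->
    mxdot (jump_composite Js Zk k (mxlim (tau k)^'+ P) (mxlim (tau k)^'- P))
      (mxlim (tau k)^'- X) =
    gp k - gm k + mxdot (Zk k) (mxlim (tau k)^'- X).
  move=> /[dup] /andP[k0 kN] k0N.
  have /andP[ak kb] := tau_in k k0N.
  rewrite /jump_composite mxdotDl mxdotBl mxdot_state_proj.
  have Xk_herm : mxlim (tau k)^'- X \is hermsymmx.
    apply: (hermsymmx_cvg _ (X_left k k0N)); near=> t; apply: X_herm.
    apply/andP; split; first by near: t; exact: nbhs_left_ge.
    have : t <= tau k by near: t; exact: nbhs_left_le.
    by move=> /le_trans; apply; exact: ltW.
  have Pk_herm : mxlim (tau k)^'+ P \is hermsymmx.
    apply: (hermsymmx_cvg _ (mxcvgP _ (P_right k kN))); near=> t; apply: P_herm.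
    apply/andP; split; last by near: t; exact: nbhs_right_le.
    have : tau k <= t by near: t; exact: nbhs_right_ge.
    by apply: le_trans; exact: ltW.
  have [_ <- //] := J_adj k k0.
  have [_ _ <-] := X_jump k k0 kb.
  congr (_ - mxdot _ _ + _).
  by rewrite (mxcvg_to_mxlim _ (mxcvg_to_state_block (X_left k k0N))).
have gp0 : gp 0 = mxdot (P (tau 0)) X10.
  by rewrite /gp (mxcvg_to_mxlim _ Pa) (mxcvg_to_mxlim _ X1a) X10E.
have main : cost tau T N Z Zk ZT X =
    mxdot (P (tau 0)) X10
    + mxdot (ZT - P b) (state_block (X b))
    + \int[mu]_(t in `[tau 0, b]) mxdot (flow_composite Fs Z P t) (X t)
    + \sum_(1 <= k < N.+1)
        mxdot (jump_composite Js Zk k (mxlim (tau k)^'+ P)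
                 (mxlim (tau k)^'- P))
              (mxlim (tau k)^'- X).
  rewrite [X in _ + X](@eq_big_nat _ _ _ 1 N.+1 _ _ jumpE) big_split/=.
  rewrite flowE h_integral gp0 mxdotBl /cost -/b /X1; ring.
by split=> // PZ; rewrite main PZ subrr mxdot0l addr0.
Unshelve. all: by end_near. Qed.
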